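(* Let $G$ be a connected group of finite Morley rank in which commutation is an equivalence relation on the set of involutions, and which has no nontrivial normal $2$-unipotent subgroup. Then $C_G(i)$ is connected for every involution $i$ of $G$.
   Context: Commutation is an equivalence relation on involutions means: for involutions $i,j,k$, if $[i,j]=1$ and $[j,k]=1$ then $[i,k]=1$. A $2$-unipotent subgroup is a definable connected nilpotent $2$-subgroup of bounded exponent. A definable group is connected if it has no proper definable subgroup of finite index. *)

(* Defs.v *)
From mathcomp Require Import all_boot.
From Stdlib Require List.

Set Implicit Arguments.
Unset Strict Implicit.
Unset Printing Implicit Defensive.

Definition nonempty (T : Type) (X : T -> Prop) : Prop := exists x, X x.
Definition subset (T : Type) (X Y : T -> Prop) : Prop := forall x, X x -> Y x.
Definition disjoint (T : Type) (X Y : T -> Prop) : Prop := forall x, X x -> Y x -> False.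
Definition finite (T : Type) (X : T -> Prop) : Prop :=
  exists s : list T, forall x, X x -> List.In x s.
Definition card_le (T : Type) (X : T -> Prop) (m : nat) : Prop :=
  exists s : list T, (List.length s <= m)%coq_nat /\ forall x, X x -> List.In x s.

Definition concat (G : Type) (k l : nat) (a : 'I_k -> G) (b : 'I_l -> G) : 'I_(k + l) -> G :=
  fun i => match split i with inl j => a j | inr j => b j end.
Definition ext (G : Type) (n : nat) (x : 'I_n -> G) (g : G) : 'I_n.+1 -> G :=
  fun i => match unlift ord_max i with Some j => x j | None => g end.
Definition fiber (G : Type) (k l : nat) (R : ('I_(k + l) -> G) -> Prop) (b : 'I_l -> G)
  : ('I_k -> G) -> Prop := fun a => R (concat a b).
Definition projr (G : Type) (k l : nat) (R : ('I_(k + l) -> G) -> Prop) : ('I_l -> G) -> Prop :=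
  fun b => exists a, R (concat a b).

(* Groups of finite Morley rank, via the Borovik--Poizat rank axioms.   *)
(* [def n] is the family of definable subsets of G^n (of the ambient     *)
(* structure, with parameters); [rk n] is the rank on (nonempty)         *)
(* definable subsets of G^n.                                             *)

Record FMRGroup := {
  carrier :> Type;
  mul : carrier -> carrier -> carrier;
  inv : carrier -> carrier;
  one : carrier;
  def : forall n, (('I_n -> carrier) -> Prop) -> Prop;
  rk : forall n, (('I_n -> carrier) -> Prop) -> nat;
  mulA : forall x y z, mul x (mul y z) = mul (mul x y) z;
  mul1g : forall x, mul one x = x;
  mulg1 : forall x, mul x one = x;
  mulVg : forall x, mul (inv x) x = one;
  mulgV : forall x, mul x (inv x) = one;
  def_true : forall n, def (fun _ : 'I_n -> carrier => True);
  def_compl : forall n (X : ('I_n -> carrier) -> Prop), def X -> def (fun x => ~ X x);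
  def_inter : forall n (X Y : ('I_n -> carrier) -> Prop), def X -> def Y -> def (fun x => X x /\ Y x);
  def_eq : forall n (i j : 'I_n), def (fun x : 'I_n -> carrier => x i = x j);
  def_mul : forall n (i j k : 'I_n), def (fun x : 'I_n -> carrier => x i = mul (x j) (x k));
  def_const : forall n (i : 'I_n) (g : carrier), def (fun x : 'I_n -> carrier => x i = g);
  def_pull : forall m n (s : 'I_m -> 'I_n) (X : ('I_m -> carrier) -> Prop),
    def X -> def (fun x : 'I_n -> carrier => X (fun i => x (s i)));
  def_proj : forall n (X : ('I_n.+1 -> carrier) -> Prop),
    def X -> def (fun x : 'I_n -> carrier => exists g, X (ext x g));
  rk_definition : forall n (A : ('I_n -> carrier) -> Prop) k, def A -> nonempty A ->
    (k.+1 <= rk A <->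
     exists F : nat -> (('I_n -> carrier) -> Prop),
       (forall i, def (F i) /\ nonempty (F i) /\ subset (F i) A /\ k <= rk (F i)) /\
       (forall i j, i <> j -> disjoint (F i) (F j)));
  rk_definable : forall k l (R : ('I_(k + l) -> carrier) -> Prop) r, def R ->
    def (fun b : 'I_l -> carrier => nonempty (fiber R b) /\ rk (fiber R b) = r);
  rk_additive : forall k l (R : ('I_(k + l) -> carrier) -> Prop) r, def R -> nonempty R ->
    (forall b, nonempty (fiber R b) -> rk (fiber R b) = r) ->
    rk R = rk (projr R) + r;
  rk_elim_inf : forall k l (R : ('I_(k + l) -> carrier) -> Prop), def R ->
    exists m, forall b, finite (fiber R b) -> card_le (fiber R b) m
}.

Section GroupNotions.
Variable G : FMRGroup.

Definition definable1 (A : G -> Prop) : Prop := def (fun x : 'I_1 -> G => A (x ord0)).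

Definition is_subgroup (H : G -> Prop) : Prop :=
  H (one G) /\ (forall x y, H x -> H y -> H (mul x y)) /\ (forall x, H x -> H (inv x)).

Definition is_normal (H : G -> Prop) : Prop :=
  forall g h, H h -> H (mul (inv g) (mul h g)).

Definition finite_index (H K : G -> Prop) : Prop :=
  exists s : list G, forall g, K g -> exists t, List.In t s /\ H (mul (inv t) g).

Definition connected (K : G -> Prop) : Prop :=
  forall H, definable1 H -> is_subgroup H -> subset H K -> finite_index H K -> subset K H.

Fixpoint gpow (g : G) (n : nat) : G :=
  match n with 0 => one G | n'.+1 => mul g (gpow g n') end.

Definition commg (x y : G) : G := mul (inv x) (mul (inv y) (mul x y)).

Fixpoint commg_seq (x : G) (ys : list G) : G :=
  match ys with nil => x | cons y ys' => commg_seq (commg x y) ys' end.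

Definition nilpotent (H : G -> Prop) : Prop :=
  exists c, forall x ys, H x -> List.length ys = c -> (forall y, List.In y ys -> H y) ->
    commg_seq x ys = one G.

Definition bounded_2group (H : G -> Prop) : Prop :=
  exists e, forall x, H x -> gpow x (2 ^ e) = one G.

Definition two_unipotent (U : G -> Prop) : Prop :=
  definable1 U /\ is_subgroup U /\ connected U /\ nilpotent U /\ bounded_2group U.

Definition involution (i : G) : Prop := i <> one G /\ mul i i = one G.

Definition commute (x y : G) : Prop := mul x y = mul y x.

Definition commutation_equiv_on_involutions : Prop :=
  forall i j k, involution i -> involution j -> involution k ->
    commute i j -> commute j k -> commute i k.

Definition centralizer (i : G) : G -> Prop := fun g => commute g i.

End GroupNotions.

(* Main.v *)
(* Let [i] be an involution, [g] in G, [c = i i^g].  The elements of Z(C(c))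
   inverted by [i] form a definable abelian group A containing [c].  An
   involution of A commutes with [i] and [i^g]; so if [i] and [i^g] do not
   commute, A has no involution, hence (finite Morley rank) is uniquely
   2-divisible, and the unique [d] in A with [d^2 = c] satisfies [i^d = i^g].
   Then [g |-> g d^-1] is a definable C(i)-equivariant map into C(i).
   If generically [i] and [i^g] do not commute, the preimages of the cosets of
   a definable subgroup of finite index in C(i) are generic and pairwise
   disjoint; as a connected group has Morley degree 1, there is only one coset.
   Otherwise [i] commutes with all its conjugates, so the elements of square 1
   commuting with [i] form a normal elementary abelian 2-group E; its connected
   component is a normal 2-unipotent subgroup, hence trivial, so E is finite
   and [i], having finitely many conjugates, is central. *)
From mathcomp Require Import all_boot.
From Stdlib Require Import Classical ClassicalEpsilon FunctionalExtensionality PropExtensionality.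
From Stdlib Require List.
Require Import Defs.

Set Implicit Arguments.
Unset Strict Implicit.
Unset Printing Implicit Defensive.

Lemma set_ext (T : Type) (P Q : T -> Prop) : (forall x, P x <-> Q x) -> P = Q.
Proof.
by move=> H; apply: functional_extensionality => x; apply: propositional_extensionality.
Qed.

(** * Definable sets *)

Section Definability.
Variable G : FMRGroup.
Implicit Types (n : nat).

Lemma def_iff n (P Q : ('I_n -> G) -> Prop) : (forall x, P x <-> Q x) -> def P -> def Q.
Proof. by move/set_ext->. Qed.

Lemma def_or n (P Q : ('I_n -> G) -> Prop) :
  def P -> def Q -> def (fun x => P x \/ Q x).
Proof.
move=> dP dQ; apply: def_iff (def_compl (def_inter (def_compl dP) (def_compl dQ))) => x.
split=> [H|]; last by tauto.
by apply: NNPP => K; apply: H; tauto.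
Qed.

Lemma def_imp n (P Q : ('I_n -> G) -> Prop) :
  def P -> def Q -> def (fun x => P x -> Q x).
Proof.
move=> dP dQ; apply: def_iff (def_or (def_compl dP) dQ) => x.
by split=> [|H]; [tauto | case: (classic (P x)); tauto].
Qed.

(** The projection axiom with the bound variable as a separate argument of [P], a form that
    [solve_def] can reach by unification. *)
Lemma def_ex n (P : ('I_n -> G) -> G -> Prop) :
  def (fun y : 'I_n.+1 -> G => P (fun j => y (lift ord_max j)) (y ord_max)) ->
  def (fun x => exists g, P x g).
Proof.
move/def_proj; apply: def_iff => x.
suff E g : (fun j => ext x g (lift ord_max j)) = x /\ ext x g ord_max = g.
  by split=> -[g Hg]; exists g; case: (E g) Hg => -> ->.
split; last by rewrite /ext unlift_none.
by apply: functional_extensionality => j; rewrite /ext liftK.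
Qed.

Lemma def_all n (P : ('I_n -> G) -> G -> Prop) :
  def (fun y : 'I_n.+1 -> G => P (fun j => y (lift ord_max j)) (y ord_max)) ->
  def (fun x => forall g, P x g).
Proof.
move/def_compl => H; apply: def_iff (def_compl (@def_ex _ (fun x g => ~ P x g) H)) => x.
split=> [K g|K [g]]; last exact.
by apply: NNPP => L; apply: K; exists g.
Qed.

(** Definability of the graph, with the value in the last coordinate, where [def_ex] binds its
    variable. *)
Definition def_fun n (t : ('I_n -> G) -> G) : Prop :=
  def (fun y : 'I_n.+1 -> G => y ord_max = t (fun j => y (lift ord_max j))).

Lemma def_fun_var n (k : 'I_n) : def_fun (fun x => x k).
Proof. exact: def_eq. Qed.

Lemma def_fun_const n (g : G) : def_fun (fun _ : 'I_n -> G => g).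
Proof. exact: def_const. Qed.

Lemma def_set n (A : G -> Prop) (t : ('I_n -> G) -> G) :
  definable1 A -> def_fun t -> def (fun x => A (t x)).
Proof.
move=> dA dt.
suff : def (fun x : 'I_n -> G => exists g, g = t x /\ A g).
  by apply: def_iff => x; split=> [[g [->]]|] //; exists (t x).
apply: def_ex; apply: def_inter => //.
exact: (def_pull (fun _ => ord_max) dA).
Qed.

Lemma def_eqt n (t u : ('I_n -> G) -> G) :
  def_fun t -> def_fun u -> def (fun x => t x = u x).
Proof.
move=> dt du.
suff : def (fun x : 'I_n -> G => exists g, g = t x /\ g = u x).
  by apply: def_iff => x; split=> [[g [->]]|] //; exists (t x).
by apply: def_ex; apply: def_inter.
Qed.

Lemma def_fun_weaken n (t : ('I_n -> G) -> G) m (s : 'I_n -> 'I_m) :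
  def_fun t -> def_fun (fun y => t (fun j => y (s j))).
Proof.
move=> dt.
pose s' (k : 'I_n.+1) : 'I_m.+1 :=
  match unlift ord_max k with Some j => lift ord_max (s j) | None => ord_max end.
apply: def_iff (def_pull s' dt) => y.
suff -> : (fun j => y (s' (lift ord_max j))) = (fun j => y (lift ord_max (s j))).
  by rewrite /s' unlift_none.
by apply: functional_extensionality => j; rewrite /s' liftK.
Qed.

Lemma def_fun_mul n (t u : ('I_n -> G) -> G) :
  def_fun t -> def_fun u -> def_fun (fun x => mul (t x) (u x)).
Proof.
move=> dt du.
(* The values of [t] and [u] are named by two extra variables, since [def_mul] speaks of coordinates
   only. *)
suff : def (fun y : 'I_n.+1 -> G => exists a, exists b,
   [/\ a = t (fun j => y (lift ord_max j)), b = u (fun j => y (lift ord_max j))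
     & y ord_max = mul a b]).
  by apply: def_iff => x; split=> [[a [b [-> ->]]]|E] //;
    exists (t (fun j => x (lift ord_max j))), (u (fun j => x (lift ord_max j))).
apply: def_ex; apply: def_ex.
have d1 := def_eqt (def_fun_var (lift ord_max ord_max))
  (def_fun_weaken (fun j => lift ord_max (lift ord_max (lift ord_max j))) dt).
have d2 := def_eqt (def_fun_var ord_max)
  (def_fun_weaken (fun j => lift ord_max (lift ord_max (lift ord_max j))) du).
have d3 := @def_mul G n.+3 (lift ord_max (lift ord_max ord_max)) (lift ord_max ord_max) ord_max.
apply: def_iff (def_inter d1 (def_inter d2 d3)) => x.
by split=> [[? [? ?]]|[]].
Qed.

Lemma def_fun_inv n (t : ('I_n -> G) -> G) : def_fun t -> def_fun (fun x => inv (t x)).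
Proof.
move=> dt.
(* The graph of the inverse is cut out by the equation [y ** t x = 1], which uses products only. *)
have H : def (fun x : 'I_n.+1 -> G =>
    mul (x ord_max) (t (fun j => x (lift ord_max j))) = one G).
  apply: (@def_eqt _ (fun x => mul (x ord_max) (t (fun j => x (lift ord_max j))))
             (fun _ => one G)); last exact: def_fun_const.
  apply: def_fun_mul; first exact: def_fun_var.
  exact: def_fun_weaken.
apply: def_iff H => x; set a := t _; split=> [H|->]; last by rewrite mulVg.
by rewrite -[x _]mulg1 -(mulgV a) mulA H mul1g.
Qed.

End Definability.

Ltac solve_def :=
  unfold definable1, centralizer, commute;
  repeat match goal with
  | |- def (fun x => _ /\ _) => apply: def_inter
  | |- def (fun x => _ \/ _) => apply: def_or
  | |- def (fun x => ~ _) => apply: def_compl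
  | |- def (fun x => _ <> _) => apply: def_compl
  | |- def (fun x => exists g, _) => apply: def_ex
  | |- def (fun x => _ = _) => apply: def_eqt
  | |- def (fun x => True) => apply: def_true
  | |- def_fun (fun x => mul _ _) => apply: def_fun_mul
  | |- def_fun (fun x => inv _) => apply: def_fun_inv
  | |- def_fun (fun x => x _) => apply: def_fun_var
  | |- def_fun (fun x => _) => apply: def_fun_const
  | |- def (fun x => forall g : carrier _, _) => apply: def_all
  | |- def (fun x => _ -> _) => apply: def_imp
  | H : def (fun x => ?A (x ord0)) |- def (fun x => ?A _) => apply: (@def_set _ _ A); first exact: H
  | H : definable1 ?A |- def (fun x => ?A _) => apply: (@def_set _ _ A); first exact: H
  end.

(** * Choice and infinite sequences *)

Lemma dependent_choice (T : Type) (R : T -> T -> Prop) (x0 : T) :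
  (forall x, exists y, R x y) -> exists f : nat -> T, f 0 = x0 /\ forall n, R (f n) (f n.+1).
Proof.
move=> H; pose s x := proj1_sig (constructive_indefinite_description _ (H x)).
exists (fun n => iter n s x0); split=> // n /=.
exact: (proj2_sig (constructive_indefinite_description _ (H _))).
Qed.

(** Dependent choice on the growing list of the elements chosen so far. *)
Lemma infinite_seq_of_lists (T : Type) (Q : T -> T -> Prop) :
  (forall s : list T, exists g, forall t, List.In t s -> Q t g) ->
  exists f : nat -> T, forall k l, l < k -> Q (f l) (f k).
Proof.
move=> H.
have [F [_ F2]] := @dependent_choice (list T)
  (fun s s' => exists g, s' = g :: s /\ forall t, List.In t s -> Q t g) [::]
  (fun s => let: ex_intro g Hg := H s in ex_intro _ (g :: s) (ex_intro _ g (conj erefl Hg))).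
have [f Hf] : exists f : nat -> T, forall n, F n.+1 = f n :: F n /\ forall t, List.In t (F n) -> Q t (f n).
  exists (fun n => proj1_sig (constructive_indefinite_description _ (F2 n))) => n.
  exact: (proj2_sig (constructive_indefinite_description _ (F2 n))).
exists f => k l lk; have [_] := Hf k; apply.
elim: k lk => [//|k IH]; have [-> _] := Hf k.
by rewrite ltnS leq_eqVlt => /orP[/eqP->|/IH]; [left|right].
Qed.

(** Pigeonhole for two colours: [Q2] holds from some point on, or [Q1] holds infinitely often. It
    serves to bound the rank of a union. *)
Lemma infinitely_often_or (Q1 Q2 : nat -> Prop) : (forall n, Q1 n \/ Q2 n) ->
  exists s : nat -> nat, injective s /\ ((forall n, Q1 (s n)) \/ (forall n, Q2 (s n))).
Proof.
move=> H; case: (classic (exists N, forall n, N <= n -> Q2 n)) => [[N HN]|K].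
  by exists (addn N); split; [exact: addnI | right=> n; apply: HN; exact: leq_addr].
have {}K N : exists n, N <= n /\ Q1 n.
  apply: NNPP => L; apply: K; exists N => n Nn.
  by case: (H n) => // Q; case: L; exists n.
have [f0 [_ Qf0]] := K 0.
have [f [Hf0 fS]] := @dependent_choice nat (fun m n => m < n /\ Q1 n) f0 (fun m => K m.+1).
have mono : {homo f : m n / m < n}.
  by apply: homo_ltn => [y x z|n]; [exact: ltn_trans | case: (fS n)].
exists f; split; last by left=> -[|n]; [rewrite Hf0 | case: (fS n)].
by move=> m n E; case: (ltngtP m n) => // /mono; rewrite E ltnn.
Qed.

(** * Rank and generic sets *)

Section Rank.
Variable G : FMRGroup.

(** The axioms leave the rank of the empty set open, so nonemptiness is built in. *)
Definition rk_ge n (A : ('I_n -> G) -> Prop) (k : nat) : Prop := nonempty A /\ k <= rk A.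

Lemma rk_geS n (A : ('I_n -> G) -> Prop) k : def A ->
  rk_ge A k.+1 <->
  exists F : nat -> ('I_n -> G) -> Prop,
    (forall i, def (F i) /\ rk_ge (F i) k /\ subset (F i) A) /\
    (forall i j, i <> j -> disjoint (F i) (F j)).
Proof.
move=> dA; split=> [[neA]|[F [HF dF]]].
  move/(rk_definition _ dA neA) => [F [HF dF]]; exists F; split=> // i.
  by have [? [? []]] := HF i.
have neA : nonempty A by have [_ [[[x Fx] _] FA]] := HF 0; exists x; apply: FA.
split=> //; apply/(rk_definition _ dA neA); exists F; split=> // i.
by have [? [[]]] := HF i.
Qed.

(** Induction on [k]: an injection carries a disjoint family of subsets of [A] to a disjoint family
    of subsets of [B], definable again by the assumption on images. *)
Lemma rk_ge_inj m n (f : ('I_m -> G) -> ('I_n -> G)) A B k :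
  def A -> def B ->
  (forall C, def C -> def (fun y => exists x, C x /\ f x = y)) ->
  (forall x y, A x -> A y -> f x = f y -> x = y) ->
  (forall x, A x -> B (f x)) -> rk_ge A k -> rk_ge B k.
Proof.
move=> + + df; elim: k A B => [|k IH] A B dA dB injf fAB.
  by move=> [[x Ax] _]; split=> //; exists (f x); apply: fAB.
move/(rk_geS _ dA) => [F [HF dF]]; apply/(rk_geS _ dB).
exists (fun i y => exists x, F i x /\ f x = y); split=> [i|i j ij y [x [Fx <-]] [x' [Fx' E]]].
  have [dFi [kFi FA]] := HF i; split; first exact: df.
  split; last by move=> y [x [Fx <-]]; apply/fAB/FA.
  apply: IH kFi => //; first exact: df.
  - by move=> x y /FA Ax /FA Ay; apply: injf.
  - by move=> x Fx; exists x.
have [_ [_ FAi]] := HF i; have [_ [_ FAj]] := HF j.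
apply: (dF i j ij x Fx); rewrite (injf _ _ _ _ (esym E)) //; first exact: FAi.
exact: FAj.
Qed.

Lemma rk_ge_sub n (A B : ('I_n -> G) -> Prop) k :
  def A -> def B -> subset A B -> rk_ge A k -> rk_ge B k.
Proof.
move=> dA dB AB; apply: (@rk_ge_inj _ _ id) => // C dC.
by apply: def_iff dC => x; split=> [|[y [? <-]]] //; exists x.
Qed.

(** Induction on [k]: every member of a family witnessing rank [k.+1] is split along [A] and [B],
    and one of the two receives a part of rank at least [k] for infinitely many members. *)
Lemma rk_ge_or n (A B : ('I_n -> G) -> Prop) k : def A -> def B ->
  rk_ge (fun x => A x \/ B x) k -> rk_ge A k \/ rk_ge B k.
Proof.
elim: k A B => [|k IH] A B dA dB.
  by move=> [[x [?|?]] _]; [left|right]; split=> //; exists x.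
move/(rk_geS _ (def_or dA dB)) => [F [HF dF]].
have : forall i, rk_ge (fun x => F i x /\ A x) k \/ rk_ge (fun x => F i x /\ B x) k.
  move=> i; have [dFi [kFi FA]] := HF i; apply: IH; try exact: def_inter.
  apply: rk_ge_sub kFi => //; first by apply: def_or; apply: def_inter.
  by move=> x Fx; case: (FA x Fx); tauto.
move/infinitely_often_or => [s [injs Hs]].
suff K C : def C -> (forall i, rk_ge (fun x => F (s i) x /\ C x) k) -> rk_ge C k.+1.
  by case: Hs => /K; [left|right]; auto.
move=> dC HC; apply/(rk_geS _ dC); exists (fun i x => F (s i) x /\ C x); split=> [i|i j ij x].
  have [dFi _] := HF (s i); split; first exact: def_inter.
  by split=> // x [].
move=> [Fi _] [Fj _]; apply: (dF (s i) (s j) _ x) => //.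
by move/injs.
Qed.

Lemma def_bigor n (F : nat -> ('I_n -> G) -> Prop) m : (forall i, def (F i)) ->
  def (fun x => exists i, i < m /\ F i x).
Proof.
move=> dF; elim: m => [|m IH].
  by apply: def_iff (def_compl (@def_true G n)) => x; split=> [[]|[? []]].
apply: def_iff (def_or IH (dF m)) => x; split=> [[[i [im Fi]]|Fm]|[i []]].
- by exists i; split=> //; apply: ltnW.
- by exists m.
- by rewrite ltnS leq_eqVlt => /orP[/eqP->|im Fi]; [right | left; exists i].
Qed.

Lemma rk_ge_bigor n (F : nat -> ('I_n -> G) -> Prop) m k : (forall i, def (F i)) ->
  rk_ge (fun x => exists i, i < m /\ F i x) k -> exists i, i < m /\ rk_ge (F i) k.
Proof.
move=> dF; have dU m' := def_bigor m' dF.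
elim: m => [[[x [? []]]]|m IH] //.
move=> H; have : rk_ge (fun x => (exists i, i < m /\ F i x) \/ F m x) k.
  apply: rk_ge_sub H => //; first exact: def_or.
  by move=> x [i []]; rewrite ltnS leq_eqVlt => /orP[/eqP->|im Fi]; [right | left; exists i].
case/rk_ge_or => // [/IH[i [im ?]]|]; last by exists m.
by exists i; split=> //; apply: ltnW.
Qed.

(** * Additivity of rank for binary relations *)

Definition unary (A : G -> Prop) : ('I_1 -> G) -> Prop := fun x => A (x ord0).

Definition rel2 (R : G -> G -> Prop) : ('I_(1 + 1) -> G) -> Prop :=
  fun x => R (x (lshift 1 ord0)) (x (rshift 1 ord0)).

Lemma fiber_rel2 (R : G -> G -> Prop) (b : 'I_1 -> G) :
  fiber (rel2 R) b = unary (fun a => R a (b ord0)).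
Proof.
apply: set_ext => a; rewrite /fiber /rel2 /concat.
by rewrite -[lshift _ _]/(unsplit (inl ord0)) -[rshift _ _]/(unsplit (inr ord0)) !unsplitK.
Qed.

Lemma nonempty_unary (A : G -> Prop) : nonempty (unary A) <-> exists a, A a.
Proof. by split=> [[x Ax]|[a Aa]]; [exists (x ord0) | exists (fun=> a)]. Qed.

Lemma rk_rel2 (R : G -> G -> Prop) r : def (rel2 R) -> (exists a b, R a b) ->
  (forall b, (exists a, R a b) -> rk (unary (fun a => R a b)) = r) ->
  rk (rel2 R) = rk (unary (fun b => exists a, R a b)) + r.
Proof.
move=> dR [a [b Rab]] Hr.
have -> : unary (fun b => exists a, R a b) = projr (rel2 R).
  apply: set_ext => y; rewrite -[projr _ _]/(nonempty (fiber (rel2 R) y)).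
  by rewrite fiber_rel2 nonempty_unary.
apply: rk_additive => //.
  suff [x Hx] : nonempty (fiber (rel2 R) (fun=> b)) by exists (concat x (fun=> b)).
  by rewrite fiber_rel2 nonempty_unary; exists a.
by move=> y; rewrite fiber_rel2 nonempty_unary; apply: Hr.
Qed.

Lemma def_rk (R : G -> G -> Prop) r : def (rel2 R) ->
  definable1 (fun b => (exists a, R a b) /\ rk (unary (fun a => R a b)) = r).
Proof.
move/(rk_definable r); apply: def_iff => b.
by rewrite fiber_rel2 nonempty_unary.
Qed.

(** Additivity fibers over the second coordinate only; double counting needs both coordinates. *)
Lemma rk_ge_swap (R : G -> G -> Prop) k : def (rel2 R) ->
  rk_ge (rel2 R) k -> rk_ge (rel2 (fun a b => R b a)) k.
Proof.
pose s (j : 'I_(1 + 1)) : 'I_(1 + 1) := rev_ord j.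
have sl : s (lshift 1 ord0) = rshift 1 ord0 by apply: val_inj.
have sr : s (rshift 1 ord0) = lshift 1 ord0 by apply: val_inj.
have ss x : (fun i => (fun j => x (s j)) (s i)) = x :> ('I_(1 + 1) -> G).
  by apply: functional_extensionality => j; rewrite /s rev_ordK.
move=> dR; apply: (@rk_ge_inj _ _ (fun x j => x (s j))) => //.
- by apply: def_iff (def_pull s dR) => x; rewrite /rel2 sl sr.
- move=> C dC; apply: def_iff (def_pull s dC) => x; split=> [Cx|[y [Cy <-]]].
    by exists (fun j => x (s j)); rewrite ss.
  by rewrite ss.
- move=> x y _ _ E.
  exact: etrans (esym (ss x)) (etrans (congr1 (fun z i => z (s i)) E) (ss y)).
- by move=> x; rewrite /rel2 sl sr.
Qed.

Lemma rk_ge_union_list (F : G -> G -> Prop) (s : list G) A k :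
  definable1 A -> (forall t, definable1 (F t)) ->
  (forall x, A x -> exists t, List.In t s /\ F t x) ->
  rk_ge (unary A) k -> exists t, List.In t s /\ rk_ge (unary (F t)) k.
Proof.
move=> + dF; elim: s A => [|t s IH] A dA HA kA.
  by have [[x /HA[t []]]] := kA.
have dFt := dF t.
have d1 : definable1 (fun x => A x /\ F t x) by solve_def.
have d2 : definable1 (fun x => A x /\ ~ F t x) by solve_def.
have : rk_ge (fun x => unary (fun x => A x /\ F t x) x \/ unary (fun x => A x /\ ~ F t x) x) k.
  apply: rk_ge_sub kA => //; first exact: def_or.
  by move=> x Ax; case: (classic (F t (x ord0))) => ?; [left|right].
case/rk_ge_or => // [kt|/(IH _ d2)].
  exists t; split; first by left.
  by apply: rk_ge_sub kt => // x [].
case=> [x [Ax nF]|u [us ku]]; last by exists u; split=> //; right.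
by have [u [[<-//|us] Fu]] := HA x Ax; exists u.
Qed.

Lemma rk_ge_inj1 (f : G -> G) (A B : G -> Prop) k :
  definable1 A -> definable1 B -> def_fun (fun x : 'I_1 -> G => f (x ord0)) ->
  (forall x y, A x -> A y -> f x = f y -> x = y) ->
  (forall x, A x -> B (f x)) -> rk_ge (unary A) k -> rk_ge (unary B) k.
Proof.
move=> dA dB df injf fAB.
have eta (x : 'I_1 -> G) : x = fun=> x ord0.
  by apply: functional_extensionality => j; rewrite ord1.
apply: (@rk_ge_inj _ _ (fun x (_ : 'I_1) => f (x ord0))) => // [C dC|x y Ax Ay E|x Ax].
- have dC' : definable1 (fun a => C (fun=> a)) by apply: def_iff dC => x; rewrite -eta.
  have : def (fun y : 'I_1 -> G => exists a, C (fun=> a) /\ f a = y ord0).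
    apply: def_ex; apply: def_inter.
      by apply: (@def_set _ _ (fun a => C (fun=> a)) _ dC'); exact: def_fun_var.
    apply: def_eqt; last exact: def_fun_var.
    exact: (def_fun_weaken (fun=> ord_max) df).
  apply: def_iff => y; split=> [[a [Ca E]]|[x [Cx <-]]].
    by exists (fun=> a); split=> //; rewrite (eta y) -E.
  by exists (x ord0); rewrite -eta.
- by rewrite (eta x) (eta y) (injf _ _ Ax Ay (congr1 (fun z => z ord0) E)).
- exact: fAB.
Qed.

(** * Generic sets: definable sets of full rank *)

Definition generic (A : G -> Prop) : Prop :=
  definable1 A /\ rk_ge (unary A) (rk (unary (fun _ : G => True))).

Lemma definable1_true : definable1 (fun _ : G => True).
Proof. exact: def_true. Qed.

Lemma rk_ge_top A k : definable1 A -> rk_ge (unary A) k -> k <= rk (unary (fun _ : G => True)).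
Proof. by move=> dA /(rk_ge_sub dA definable1_true) H; case: H. Qed.

Lemma generic_true : generic (fun _ => True).
Proof. by split; [exact: definable1_true | split=> //; exists (fun=> one G)]. Qed.

Lemma generic_sub A B : definable1 B -> subset A B -> generic A -> generic B.
Proof.
by move=> dB AB [dA kA]; split=> //; apply: rk_ge_sub kA => // x; apply: AB.
Qed.

Lemma generic_split A B : definable1 B -> generic A ->
  generic (fun x => A x /\ B x) \/ generic (fun x => A x /\ ~ B x).
Proof.
move=> dB [dA kA].
have d1 : definable1 (fun x => A x /\ B x) by solve_def.
have d2 : definable1 (fun x => A x /\ ~ B x) by solve_def.
have : rk_ge (fun x => unary (fun x => A x /\ B x) x \/ unary (fun x => A x /\ ~ B x) x)
         (rk (unary (fun _ : G => True))).
  apply: rk_ge_sub kA => //; first exact: def_or.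
  by move=> x Ax; case: (classic (B (x ord0))) => ?; [left|right].
by case/rk_ge_or => // ?; [left|right].
Qed.

Lemma generic_ex A : generic A -> exists x, A x.
Proof. by move=> [_ [/nonempty_unary]]. Qed.

Lemma no_disjoint_generic (F : nat -> G -> Prop) : (forall i, generic (F i)) ->
  (forall i j x, i < j -> F i x -> F j x -> False) -> False.
Proof.
move=> gF dF; set N := rk (unary (fun _ : G => True)).
suff : rk_ge (unary (fun _ : G => True)) N.+1 by case; rewrite ltnn.
apply/(rk_geS _ definable1_true); exists (fun i => unary (F i)); split=> [i|i j ij x Fi Fj].
  by have [] := gF i.
by case: (ltngtP i j) => // H; [exact: (dF i j (x ord0)) | exact: (dF j i (x ord0))].
Qed.

(** Removing from each [F k] all earlier sets makes the family disjoint. What is removed is a finite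
    union of nongeneric sets, so the remainders stay generic. *)
Lemma no_almost_disjoint_generic (F : nat -> G -> Prop) : (forall i, generic (F i)) ->
  (forall i j, i < j -> ~ generic (fun x => F i x /\ F j x)) -> False.
Proof.
move=> gF dF.
have dFi i : definable1 (F i) by case: (gF i).
pose U k x := exists i, i < k /\ F i x.
have dU k : definable1 (U k) by apply: (@def_bigor 1 (fun i => unary (F i))).
apply: (@no_disjoint_generic (fun k x => F k x /\ ~ U k x)) => [k|i j x ij [Fi _] [_]]; last first.
  by apply; exists i.
case: (generic_split (dU k) (gF k)) => // -[d1 k1]; exfalso.
have d2 i : definable1 (fun x => F i x /\ F k x).
  by have := dFi i; have := dFi k => *; solve_def.
have [|i [ik ki]] := @rk_ge_bigor 1 (fun i => unary (fun x => F i x /\ F k x)) k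
  (rk (unary (fun _ : G => True))) d2.
  apply: rk_ge_sub k1 => //; first exact: (@def_bigor 1 (fun i => unary (fun x => F i x /\ F k x))).
  by move=> x [Fk [i [ik Fi]]]; exists i.
exact: (dF i k ik).
Qed.

End Rank.

(** * Groups of finite Morley rank *)

Section Group.
Variable G : FMRGroup.
Local Notation "x ** y" := (mul x y) (at level 40, left associativity).
Implicit Types (x y g : G) (A B : G -> Prop).

Lemma mulgA' x y z : x ** y ** z = x ** (y ** z).
Proof. by rewrite mulA. Qed.

Lemma mulKg' x y : inv x ** (x ** y) = y.
Proof. by rewrite mulA mulVg mul1g. Qed.

Lemma mulVKg' x y : x ** (inv x ** y) = y.
Proof. by rewrite mulA mulgV mul1g. Qed.

Lemma invg_eq x y : x ** y = one G -> inv x = y.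
Proof. by move=> E; rewrite -[inv x]mulg1 -E mulKg'. Qed.

Lemma invgK' x : inv (inv x) = x.
Proof. by apply: invg_eq; rewrite mulVg. Qed.

Lemma inv1g : inv (one G) = one G.
Proof. by apply: invg_eq; rewrite mul1g. Qed.

Lemma invgM x y : inv (x ** y) = inv y ** inv x.
Proof. by apply: invg_eq; rewrite !mulgA' mulVKg' mulgV. Qed.

Definition grpE := (mulgA', mul1g, mulg1, mulVg, mulgV, mulKg', mulVKg', invgM, invgK', inv1g).

Lemma mulgI g x y : g ** x = g ** y -> x = y.
Proof. by move/(congr1 (mul (inv g))); rewrite !mulKg'. Qed.

Lemma mulIg g x y : x ** g = y ** g -> x = y.
Proof. by move/(congr1 (fun z => z ** inv g)); rewrite !grpE. Qed.

(** * Translates and intersections of generic sets *)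

Lemma rk_ge_translate g A k : definable1 A ->
  rk_ge (unary A) k -> rk_ge (unary (fun x => A (g ** x))) k.
Proof.
move=> dA; apply: (@rk_ge_inj1 _ (fun x => inv g ** x)); try solve_def.
- by move=> x y _ _ /mulgI.
- by move=> x; rewrite mulVKg'.
Qed.

Lemma generic_translate g A : generic A -> generic (fun x => A (g ** x)).
Proof.
by move=> [dA kA]; split; [solve_def | apply: rk_ge_translate].
Qed.

Lemma generic_translate_r g A : generic A -> generic (fun x => A (x ** g)).
Proof.
move=> [dA kA]; split; first by solve_def.
apply: (@rk_ge_inj1 _ (fun x => x ** inv g)) kA; try solve_def.
- by move=> x y _ _ /mulIg.
- by move=> x; rewrite mulgA' mulVg mulg1.
Qed.

Lemma generic_translate_eq g A : generic (fun x => A (g ** x)) -> generic A.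
Proof.
move/(generic_translate (inv g)); congr generic.
by apply: functional_extensionality => x; rewrite mulVKg'.
Qed.

(* Otherwise generic sets could be split forever, giving infinitely many
   disjoint generic sets. *)
Lemma exists_generic_degree1 : exists A, generic A /\
  forall B, definable1 B -> generic (fun x => A x /\ B x) ->
    ~ generic (fun x => A x /\ ~ B x).
Proof.
apply: NNPP => K.
pose T := {A : G -> Prop | @generic G A}.
have [|] := @dependent_choice T (fun U V => subset (proj1_sig V) (proj1_sig U) /\
    generic (fun x => proj1_sig U x /\ ~ proj1_sig V x)) (exist (@generic G) _ (generic_true G)).
  move=> [A gA]; apply: NNPP => L; apply: K; exists A; split=> // B dB g1 g2.
  apply: L; exists (exist (@generic G) _ g1); split=> [x []|] //=.
  apply: generic_sub g2; last by move=> x [Ax nB]; split=> // -[].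
  have [dA _] := gA; solve_def.
move=> F [_ FS]; apply: (@no_disjoint_generic G (fun n x => proj1_sig (F n) x /\ ~ proj1_sig (F n.+1) x)).
  by move=> n; case: (FS n).
move=> i j x ij [_ nFi] [Fj _]; apply: nFi.
elim: j ij Fj => // j IH; rewrite ltnS leq_eqVlt => /orP[/eqP-> //|ij] Fj.
by apply: IH => //; case: (FS j) => H _; apply: H.
Qed.

(* Double counting of the pairs [(g, x)] with [A x] and [B (g ** x)]. *)
Lemma generic_meets_translate A B : generic A -> generic B ->
  exists g, generic (fun x => A x /\ B (g ** x)).
Proof.
move=> gA gB; have [dA kA] := gA; have [dB kB] := gB.
apply: NNPP => K; pose N := rk (unary (fun _ : G => True)).
have rkN (C : G -> Prop) : generic C -> rk (unary C) = N.
  move=> [dC [neC kC]]; apply/eqP; rewrite eqn_leq; apply/andP; split=> //.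
  exact: (rk_ge_top dC (conj neC (leqnn _))).
pose R x g := A x /\ B (g ** x).
have dR : def (rel2 R) by rewrite /rel2 /R; solve_def.
have dR' : def (rel2 (fun g x => R x g)) by rewrite /rel2 /R; solve_def.
have [[a Aa] [b Bb]] := (generic_ex gA, generic_ex gB).
have ex_g x : exists g, B (g ** x) by exists (b ** inv x); rewrite !grpE.
(* Over each [x] in [A] the fiber is a right translate of [B], of rank [N], and the base [A] has
   rank [N]. *)
have kR' : rk_ge (rel2 (fun g x => R x g)) (N + N).
  have [g Hg] := ex_g a; split.
     exists (concat (fun=> g) (fun=> a)).
    rewrite -[rel2 _ _]/(fiber (rel2 (fun g x => R x g)) (fun=> a) (fun=> g)) fiber_rel2.
    by split.
  rewrite (@rk_rel2 _ _ N dR') => [||x [h [Ax _]]].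
  - rewrite leq_add2r; have -> // : (fun x => exists g, R x g) = A; last by rewrite rkN.
    by apply: set_ext => x; split=> [[h []]|Ax] //; have [g' ?] := ex_g x; exists g'.
  - by exists g, a.
  - have -> : (fun g => R x g) = (fun g => B (g ** x)) by apply: set_ext => g'; rewrite /R; tauto.
    exact/rkN/generic_translate_r.
have kR := rk_ge_swap dR' kR'.
(* [R] is cut according to the rank [r] of the fiber over [g]. If no fiber is generic, only [r < N]
   occurs, so one of finitely many pieces has rank at least [N + N]. *)
pose Rr r x g := R x g /\ ((exists x, R x g) /\ rk (unary (fun x => R x g)) = r).
have dRr r : def (rel2 (Rr r)).
  apply: def_inter => //.
  have d := def_rk r dR.
  by apply: (@def_set _ _ (fun g => (exists x, R x g) /\ rk (unary (fun x => R x g)) = r)) => //; exact: def_fun_var.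
have [|r [rN [[z Hz] kr]]] := @rk_ge_bigor G _ (fun r => rel2 (Rr r)) N (N + N) dRr.
  apply: rk_ge_sub kR => //; first exact: (@def_bigor _ _ (fun r => rel2 (Rr r))).
  move=> x Rx; set g := x (rshift 1 ord0).
  exists (rk (unary (fun y => R y g))); split; last by split=> //; split=> //; exists (x (lshift 1 ord0)).
  rewrite ltnNge; apply/negP => H; apply: K; exists g; split; first by solve_def.
  by split=> //; exists (fun=> x (lshift 1 ord0)).
(* Fibering over [g] gives that piece rank at most [N + r], which is less than [N + N]. *)
move: kr; rewrite (@rk_rel2 _ _ r (dRr r)).
- apply/negP; rewrite -ltnNge; apply: (@leq_ltn_trans (N + r)); last by rewrite ltn_add2l.
  rewrite leq_add2r; apply: (@rk_ge_top _ (fun g => exists x, Rr r x g)).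
    rewrite /Rr; have d := def_rk r dR; apply: def_iff (d) => y.
    by split=> [[[x Rx] E]|[x [Rx [? ?]]]]; [exists x; split=> //; split=> //; exists x | split].
  split=> //; exists (fun=> z (rshift 1 ord0)); by exists (z (lshift 1 ord0)).
- by do 2!eexists; exact: Hz.
- move=> g [x [Rx [exR <-]]]; congr (rk (unary _)); apply: set_ext => y.
  by split=> [[]|] //.
Qed.

(* If D is generic of degree 1, the g for which D and gD are equal up to a
   nongeneric set form a definable subgroup S of finite index, so S = G. *)
Lemma connected_generic_meet A B : connected (fun _ : G => True) ->
  generic A -> generic B -> exists x, A x /\ B x.
Proof.
move=> conG.
have [D [gD deg1]] := exists_generic_degree1.
have [dD kD] := gD.
(* A translate of [D] also has degree 1, so two sets meeting it generically meet each other
   generically. *)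
have meetD g B1 B2 : generic (fun x => D (g ** x) /\ B1 x) -> generic (fun x => D (g ** x) /\ B2 x) ->
    definable1 B1 -> definable1 B2 -> generic (fun x => B1 x /\ B2 x).
  move=> g1 g2 d1 d2; have d : definable1 (fun x => B1 x /\ B2 x) by solve_def.
  case: (generic_split d1 g2); first by apply: generic_sub => // x [[]].
  move=> g3; exfalso.
  have d1' : definable1 (fun x => B1 (inv g ** x)) by solve_def.
  apply: (deg1 _ d1').
    apply: (@generic_translate_eq g); move: g1; congr generic.
    by apply: functional_extensionality => x; rewrite mulKg'.
  apply: generic_sub (generic_translate (inv g) g3); first by solve_def.
  by move=> x [[]]; rewrite mulVKg'.
pose S g := generic (fun x => D x /\ D (inv g ** x)).
(* Genericity of a fiber means that its rank is the top rank, a definable condition on the parameter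
   by [def_rk]. *)
have dS : definable1 S.
  pose R x g := D x /\ D (inv g ** x).
  have dR : def (rel2 R) by rewrite /rel2 /R; solve_def.
  apply: def_iff (def_rk (rk (unary (fun _ : G => True))) dR) => y.
  split=> [[[x Hx] E]|[dx [nex kx]]].
    split; first by rewrite /R; solve_def.
    by split; [exists (fun=> x) | rewrite -E].
  split; first by have /nonempty_unary := nex.
  apply/eqP; rewrite eqn_leq; apply/andP; split=> //.
  exact: (rk_ge_top dx (conj nex (leqnn _))).
have S1 : S (one G).
  apply: generic_sub gD; first by solve_def.
  by move=> x Dx; rewrite inv1g mul1g.
have SV g : S g -> S (inv g).
  move/(generic_translate g); apply: generic_sub; first by solve_def.
  by move=> x; rewrite mulKg' invgK'; tauto.
have SM g h : S g -> S h -> S (g ** h).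
  move=> Sg Sh.
  have : generic (fun x => D x /\ D (inv (g ** h) ** x)).
    apply: (@meetD (inv g)); try solve_def.
      by apply: generic_sub Sg; [solve_def | move=> x; tauto].
    apply: generic_sub (generic_translate (inv g) Sh); first by solve_def.
    by move=> x; rewrite invgM mulgA'.
  by [].
have fS : finite_index S (fun _ => True).
  apply: NNPP => K.
  have [s|f Hf] := @infinite_seq_of_lists G (fun t g => ~ S (inv t ** g)).
    apply: NNPP => L; apply: K; exists s => g _; apply: NNPP => M; apply: L; exists g => t ts St.
    by apply: M; exists t.
  (* Elements of distinct cosets of [S] move [D] to translates with nongeneric intersection. *)
  apply: (@no_almost_disjoint_generic G (fun k x => D (inv (f k) ** x))) => [k|l k lk H].
    exact: generic_translate.
  apply: (Hf k l lk).
  apply: generic_sub (generic_translate (f l) H); first by solve_def.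
  by move=> x; rewrite !grpE.
have allS : forall g, S g by move=> g; apply: (conG S).
(* For a suitable [g] the translate [gD] meets [B1] generically, and by [allS] it also meets [D]
   generically. *)
have meet B1 : generic B1 -> generic (fun x => D x /\ B1 x).
  move=> gB; have [dB kB] := gB.
  have [g Hg] := generic_meets_translate gD gB.
  apply: (@meetD (inv g)) => //; last first.
    apply: generic_sub (generic_translate (inv g) Hg); first by solve_def.
    by move=> x; rewrite mulVKg'.
  by apply: generic_sub (allS g); [solve_def | move=> x; tauto].
move=> gA gB; have [[dA _] [dB _]] := (gA, gB).
have gAB : generic (fun x => A x /\ B x).
  apply: (@meetD (one G)) => //.
    by apply: generic_sub (meet _ gA); [solve_def | move=> x; rewrite mul1g].
  by apply: generic_sub (meet _ gB); [solve_def | move=> x; rewrite mul1g].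
exact: generic_ex gAB.
Qed.

(** * Finite index and connected components *)

Lemma rk_ge_finite_index (H K : G -> Prop) k : definable1 H -> definable1 K ->
  finite_index H K -> rk_ge (unary K) k -> rk_ge (unary H) k.
Proof.
move=> dH dK [s Hs] kK.
have [||t [_ /(rk_ge_translate t)]] := @rk_ge_union_list G (fun t g => H (inv t ** g)) s K k dK _ _ kK.
- by move=> t; solve_def.
- by move=> g /Hs.
have -> : (fun x => H (inv t ** (t ** x))) = H.
  by apply: functional_extensionality => x; rewrite mulKg'.
by apply; solve_def.
Qed.

Lemma finite_index_trans (H K L : G -> Prop) :
  subset K L -> finite_index H K -> finite_index K L -> finite_index H L.
Proof.
move=> KL [s Hs] [s' Hs']; exists (List.flat_map (fun t' => List.map (fun t => t' ** t) s) s').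
move=> g /Hs' [t' [t's /Hs[t [ts Ht]]]]; exists (t' ** t); split; last by rewrite invgM mulgA'.
by apply/List.in_flat_map; exists t'; split=> //; apply: List.in_map.
Qed.

Lemma finite_index_inter (H K L : G -> Prop) : is_subgroup H -> is_subgroup K ->
  finite_index H L -> finite_index K L -> finite_index (fun x => H x /\ K x) L.
Proof.
move=> [H1 [HM HV]] [K1 [KM KV]] [s Hs] [s' Hs'].
pose P t t' g := L g /\ H (inv t ** g) /\ K (inv t' ** g).
(* One representative for each nonempty intersection of a coset of [H] and a coset of [K] within
   [L]; for an empty intersection the value is arbitrary. *)
pose c t t' := epsilon (inhabits (one G)) (P t t').
exists (List.flat_map (fun t' => List.map (fun t => c t t') s) s').
move=> g Lg; have [t [ts Ht]] := Hs g Lg; have [t' [t's' Ht']] := Hs' g Lg.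
exists (c t t'); split.
  by apply/List.in_flat_map; exists t'; split=> //; apply: (List.in_map (fun t => c t t')).
have [_ [Hc Kc]] : P t t' (c t t') by apply: epsilon_spec; exists g.
split.
  by have := HM _ _ (HV _ Hc) Ht; rewrite !grpE.
by have := KM _ _ (KV _ Kc) Ht'; rewrite !grpE.
Qed.

(** Used to pass from finitely many conjugates of an involution to finite index of its
    centralizer. *)
Lemma finite_index_fibers (T : Type) (f : G -> T) (H : G -> Prop) (s : list T) :
  (forall g, List.In (f g) s) -> (forall t g, f t = f g -> H (inv t ** g)) ->
  finite_index H (fun _ => True).
Proof.
move=> fs fH.
suff [l Hl] : exists l, forall g, List.In (f g) s -> exists t, List.In t l /\ f t = f g.
  by exists l => g _; have [t [tl E]] := Hl g (fs g); exists t; split=> //; apply: fH.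
elim: s {fs} => [|e s [l IH]]; first by exists nil.
case: (classic (exists t, f t = e)) => [[t <-]|K].
  exists (t :: l) => g [E|/IH[u [ul E]]]; first by exists t; split=> //; left.
  by exists u; split=> //; right.
by exists l => g [E|/IH //]; case: K; exists g.
Qed.

(** Otherwise there is an infinite strictly descending chain of definable subgroups of finite index.
    Each difference of successive terms contains a coset of the smaller one, of full rank in [L],
    and these cosets are disjoint. *)
Lemma exists_connected_component (L : G -> Prop) : definable1 L -> is_subgroup L ->
  exists K, [/\ definable1 K, is_subgroup K, subset K L, finite_index K L & connected K].
Proof.
move=> dL sL; apply: NNPP => N.
pose P (K : G -> Prop) := [/\ definable1 K, is_subgroup K, subset K L & finite_index K L].
have PL : P L.
  split=> //; exists [:: one G] => g Lg; exists (one G); split; first by left.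
  by rewrite inv1g mul1g.
have [|F [_ FS]] := @dependent_choice {K : G -> Prop | P K} (fun U V => subset (proj1_sig V) (proj1_sig U) /\
    exists x, proj1_sig U x /\ ~ proj1_sig V x) (exist P L PL).
  move=> [K PK] /=; have [dK sK KL fK] := PK.
  apply: NNPP => M; apply: N; exists K; split=> // H dH sH HK fH x Kx.
  apply: NNPP => nH; apply: M.
  have PH : P H.
    by split=> //; [move=> y /HK /KL | apply: finite_index_trans fK].
  by exists (exist P H PH); split=> //=; exists x.
have [x Hx] : exists x : nat -> G, forall n, proj1_sig (F n) (x n) /\ ~ proj1_sig (F n.+1) (x n).
  exists (fun n => proj1_sig (constructive_indefinite_description _ (proj2 (FS n)))) => n.
  exact: (proj2_sig (constructive_indefinite_description _ (proj2 (FS n)))).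
have Fdecr m n : m <= n -> subset (proj1_sig (F n)) (proj1_sig (F m)).
  elim: n => [|n IH]; first by rewrite leqn0 => /eqP->.
  rewrite leq_eqVlt => /orP[/eqP-> //|/IH H] y Fy; apply: H; case: (FS n) => + _; exact.
have PF n : P (proj1_sig (F n)) := proj2_sig (F n).
pose C n y := proj1_sig (F n.+1) (inv (x n) ** y).
have CF n : subset (C n) (proj1_sig (F n)).
  move=> y Cy; have [_ [_ [FM _]] _ _] := PF n.
  rewrite -(mulVKg' (x n) y); apply: FM; first by case: (Hx n).
  exact: (Fdecr n n.+1).
have nCF n y : C n y -> ~ proj1_sig (F n.+1) y.
  move=> Cy Fy; have [_ [_ [FM FV]] _ _] := PF n.+1; have [_ []] := Hx n.
  by have := FM _ _ Fy (FV _ Cy); rewrite !grpE.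
suff : rk_ge (unary L) (rk (unary L)).+1 by case; rewrite ltnn.
apply/(rk_geS _ dL); exists (fun n => unary (C n)); split=> [n|m n mn y Cm Cn].
  have [dF _ _ fF] := PF n.+1.
  have dC : definable1 (C n) by rewrite /C; solve_def.
  split=> //.
  split; last by have [_ _ FL _] := PF n; move=> y /CF /FL.
  apply: rk_ge_translate => //; apply: rk_ge_finite_index fF _ => //.
  by split=> //; exists (fun=> one G); have [] := sL.
have K m' n' : m' < n' -> C m' (y ord0) -> C n' (y ord0) -> False.
  by move=> lt /nCF + /CF /(Fdecr _ _ lt).
by case: (ltngtP m n) mn => // lt _; [exact: (K m n) | exact: (K n m)].
Qed.

(* If [c] is not a square, the images of the coset [c A^2] under iterated
   squaring are infinitely many disjoint subsets of A of full rank. *)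
Lemma square_surjective A : definable1 A -> is_subgroup A ->
  (forall x y, A x -> A y -> x ** y = y ** x) ->
  (forall x, A x -> x ** x = one G -> x = one G) ->
  forall c, A c -> exists d, A d /\ d ** d = c.
Proof.
move=> dA [A1 [AM AV]] abA A2 c Ac; apply: NNPP => K.
have sq_inj x y : A x -> A y -> x ** x = y ** y -> x = y.
  move=> Ax Ay E; apply: (@mulIg (inv y)); rewrite mulgV; apply: A2; first exact/AM/AV.
  rewrite !mulgA' (mulA (inv y)) -(abA x) //; last exact: AV.
  by rewrite !mulgA' mulA E !grpE.
pose sqn j x := iter j (fun y => y ** y) x.
have sqnA j x : A x -> A (sqn j x) by move=> Ax; elim: j => //= j IH; apply: AM.
have sqn_inj j x y : A x -> A y -> sqn j x = sqn j y -> x = y.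
  by move=> Ax Ay; elim: j => //= j IH /sq_inj H; apply/IH/H; apply: sqnA.
have Ag a : A a -> A (c ** (a ** a)) by move=> Aa; apply: (AM _ _ Ac); apply: AM.
have nosq a b : A a -> A b -> c ** (a ** a) <> b ** b.
  move=> Aa Ab E; apply: K; exists (b ** inv a); split; first exact/AM/AV.
  rewrite !mulgA' (mulA (inv a)) -(abA b) //; last exact: AV.
  by rewrite !mulgA' mulA -E !grpE.
pose f j a := sqn j (c ** (a ** a)).
pose F j y := exists a, A a /\ f j a = y.
have df n (t : ('I_n -> G) -> G) j : def_fun t -> def_fun (fun z => f j (t z)).
  move=> dt; elim: j => [|j IH]; first by rewrite /f /=; do ![apply: def_fun_mul=> //]; solve_def.
  exact: def_fun_mul.
have dF j : definable1 (F j).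
  apply: def_ex; apply: def_inter; first by solve_def.
  by apply: def_eqt; [apply: (df _ (fun z => z ord_max)) | ]; solve_def.
suff : rk_ge (unary A) (rk (unary A)).+1 by case; rewrite ltnn.
apply/(rk_geS _ dA); exists (fun j => unary (F j)); split=> [j|m n mn y].
  split; first exact: dF.
  split; last first.
    by move=> y; rewrite /unary /F => -[a [Aa <-]]; apply/sqnA/Ag.
  apply: (@rk_ge_inj1 _ (f j) A) => //.
  - by apply: (df _ (fun z => z ord0)); solve_def.
  - by move=> x y Ax Ay /sqn_inj H; apply: sq_inj => //; apply: (@mulgI c); apply: H; apply: Ag.
  - by move=> x Ax; exists x.
  - by split=> //; exists (fun=> one G).
have disj k l a b : k < l -> A a -> A b -> f k a = f l b -> False.
  (* Cancelling [k] squarings leaves at least one on the right, so [c ** (a ** a)] would be a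
     square, against [nosq]. *)
  move=> kl Aa Ab; rewrite /f -(subnKC kl) /sqn addSnnS iterD => /sqn_inj H.
  by apply: (nosq a (sqn (l - k.+1) (c ** (b ** b)))) => //;
     [apply/sqnA/Ag | apply: H; [exact: Ag | exact: (sqnA (l - k.+1).+1 _ (Ag _ Ab))]].
rewrite /unary /F => -[a [Aa Ea]] [b [Ab Eb]].
by case: (ltngtP m n) mn => // lt _; [apply: (@disj m n a b) | apply: (@disj n m b a)]; rewrite ?Ea ?Eb.
Qed.

(* The elements of Z(C(ij)) inverted by [i]: a uniformly definable substitute
   for the definable hull of [ij]. *)
Definition inverted (i j d : G) : Prop :=
  (forall x, x ** (i ** j) = i ** j ** x -> x ** d = d ** x) /\ i ** (d ** i) = inv d.

Section Inverted.
Variables i j : G.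
Hypotheses (ii : i ** i = one G) (jj : j ** j = one G).

Let iK x : i ** (i ** x) = x.
Proof. by rewrite mulA ii mul1g. Qed.

Lemma inverted_mul : inverted i j (i ** j).
Proof. by split=> //; rewrite invgM (invg_eq ii) (invg_eq jj) !mulgA' iK. Qed.

(** As [i ** j] centralizes itself, [x] commutes with it; hence [x] lies in C(ij), and [y] commutes
    with all of C(ij). *)
Lemma inverted_comm x y : inverted i j x -> inverted i j y -> x ** y = y ** x.
Proof. by move=> [Zx _] [Zy _]; apply: Zy; rewrite Zx. Qed.

Lemma inverted_subgroup : is_subgroup (inverted i j).
Proof.
split; [|split].
- by split=> [x _|]; rewrite ?mulg1 ?mul1g ?inv1g.
- move=> x y Ax Ay; have E := inverted_comm Ax Ay.
  case: Ax Ay => [Zx Ix] [Zy Iy]; split=> [z Hz|].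
    by rewrite mulA Zx // mulgA' Zy // mulA.
  by rewrite [in RHS]E invgM -Ix -Iy !mulgA' iK.
- move=> x [Zx Ix]; split=> [z /Zx E|].
    by apply: (@mulgI x); apply: (@mulIg x); rewrite !grpE E.
  by rewrite -{2}Ix !invgM (invg_eq ii) mulgA'.
Qed.

(** Being its own inverse, [x] is fixed by conjugation with [i]. It also commutes with [i ** j],
    hence with [j]. *)
Lemma inverted_involution x : inverted i j x -> x ** x = one G -> commute i x /\ commute x j.
Proof.
move=> [Zx Ix] xx.
have Ci : i ** x = x ** i.
  by apply: (@mulIg i); rewrite mulgA' Ix (invg_eq xx) mulgA' ii mulg1.
split=> //; apply: (@mulgI i).
have := Zx _ (erefl (i ** j ** (i ** j))); rewrite mulgA' => ->.
by rewrite !mulA Ci.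
Qed.

End Inverted.

(** * Centralizers of involutions *)

Section Centralizer.
Hypothesis conG : connected (fun _ : G => True).
Variable i : G.
Hypothesis inv_i : involution i.

Let ii : i ** i = one G := proj2 inv_i.

Let iK x : i ** (i ** x) = x.
Proof. by rewrite mulA ii mul1g. Qed.

Definition conj_i (g : G) : G := inv g ** (i ** g).

Lemma conj_i_sq g : conj_i g ** conj_i g = one G.
Proof. by rewrite /conj_i !mulgA' mulVKg' iK mulVg. Qed.

Lemma involution_conj_i g : involution (conj_i g).
Proof.
split; last exact: conj_i_sq.
move=> E; case: inv_i => + _; apply.
apply: (@mulgI (inv g)); apply: (@mulIg g).
by rewrite mulgA' -/(conj_i g) E mulg1 mulVg.
Qed.

Lemma centralizer_subgroup x : is_subgroup (centralizer x).
Proof.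
split; [by rewrite /centralizer /commute mul1g mulg1 | split].
  by move=> y z; rewrite /centralizer /commute => Ey Ez; rewrite mulgA' Ez mulA Ey mulgA'.
move=> y; rewrite /centralizer /commute => Ey.
by apply: (@mulgI y); apply: (@mulIg y); rewrite !grpE Ey.
Qed.

Lemma definable_centralizer x : definable1 (centralizer x).
Proof. solve_def. Qed.

Hypothesis comm_equiv : commutation_equiv_on_involutions G.

(** * The case where [i] generically does not commute with its conjugates *)

Let apart (g : G) : Prop := ~ commute i (conj_i g).

Let root (g d : G) : Prop := inverted i (conj_i g) d /\ d ** d = i ** conj_i g.

Lemma inverted_no_involution g : apart g ->
  forall x, inverted i (conj_i g) x -> x ** x = one G -> x = one G.
Proof.
move=> ng x Ax xx; apply: NNPP => x1; apply: ng.
have [Cix Cxj] := inverted_involution ii Ax xx.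
by apply: (comm_equiv inv_i (conj x1 xx) (involution_conj_i g)).
Qed.

Lemma definable_inverted j : definable1 (inverted i j).
Proof. rewrite /inverted; solve_def. Qed.

Lemma root_ex g : apart g -> exists d, root g d.
Proof.
move=> ng; rewrite /root; apply: square_surjective.
- exact: definable_inverted.
- exact: (inverted_subgroup (conj_i g) ii).
- exact: inverted_comm.
- exact: inverted_no_involution.
- exact: (inverted_mul ii (conj_i_sq g)).
Qed.

Lemma root_unique g d e : apart g -> root g d -> root g e -> d = e.
Proof.
move=> ng [Ad Ed] [Ae Ee].
have [_ [AM AV]] := inverted_subgroup (conj_i g) ii.
apply: (@mulIg (inv e)); rewrite mulgV; apply: (inverted_no_involution ng); first exact/AM/AV.
rewrite !mulgA' (mulA (inv e)) -(inverted_comm Ad (AV _ Ae)).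
by rewrite !mulgA' mulA Ed -Ee !grpE.
Qed.

(** Since [i] inverts [d], the conjugate of [i] by [d] is [i ** (d ** d)], which equals
    [conj_i g]. *)
Lemma root_conj g d : root g d -> commute (g ** inv d) i.
Proof.
move=> [[_ Id] Ed].
have Hd : inv d ** (i ** d) = conj_i g.
  by rewrite -Id !mulgA' iK Ed iK.
rewrite /commute; apply: (@mulIg d); apply: (@mulgI (inv g)).
by rewrite !mulgA' mulKg' Hd mulVg mulg1.
Qed.

(** The preimage of the coset [tH] under the map sending [g] to [g ** inv d], with [d] the root for
    [g]. *)
Let piece (H : G -> Prop) (t g : G) : Prop :=
  apart g /\ exists d, root g d /\ H (inv t ** (g ** inv d)).

Lemma definable_piece (H : G -> Prop) t : definable1 H -> definable1 (piece H t).
Proof.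
move=> dH; rewrite /piece /apart /root /inverted /conj_i; solve_def.
Qed.

Lemma conj_i_centralizer c g : commute c i -> conj_i (c ** g) = conj_i g.
Proof.
move=> Ec; rewrite /conj_i invgM !mulgA'; congr (_ ** _).
by rewrite (mulA i) -Ec mulgA' mulKg'.
Qed.

(** Left multiplication of [g] by an element of C(i) changes neither [conj_i g] nor the root, so the
    map to C(i) is equivariant. *)
Lemma piece_translate (H : G -> Prop) t c g : commute c i ->
  piece H t (c ** g) <-> piece H (inv c ** t) g.
Proof.
move=> Cc; rewrite /piece /apart /root (conj_i_centralizer _ Cc).
by split=> -[ng [d [rd Hd]]]; split=> //; exists d; split=> //; move: Hd; rewrite !grpE.
Qed.

Lemma connected_centralizer_of_generic : generic apart -> connected (centralizer i).
Proof.
move=> [dX kX] H dH [H1 [HM HV]] HC [s Hs] c Cc; apply: NNPP => nHc.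
have [_ [CM CV]] := centralizer_subgroup i.
(* The pieces of the finitely many cosets cover [apart], so one of them is generic. *)
have [g ng|t [_ kt]] := @rk_ge_union_list G (piece H) s apart _ dX (fun t => definable_piece t dH) _ kX.
  have [d rd] := root_ex ng; have [t [ts Ht]] := Hs _ (root_conj rd).
  by exists t; split=> //; split=> //; exists d.
have gt : generic (piece H t) by split=> //; apply: definable_piece.
have [g [ng [d [rd Hd]]]] := generic_ex gt.
have Ct : centralizer i t.
  have := CM _ _ (root_conj rd) (CV _ (HC _ Hd)); by rewrite !grpE.
(* [t c^-1 t^-1] lies in C(i) and moves the coset [t c H] to [t H]. *)
have Cu : commute (t ** inv c ** inv t) i :=
  CM _ _ (CM _ _ Ct (CV _ Cc)) (CV _ Ct).
have gu : generic (piece H (t ** c)).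
  apply: generic_sub (generic_translate (t ** inv c ** inv t) gt); first exact: definable_piece.
  by move=> x /(piece_translate _ _ _ Cu); rewrite !grpE.
have [x [[nx [e [re He]]] [_ [e' [re' He']]]]] := connected_generic_meet conG gt gu.
(* With a single root [e], the element [x ** inv e] lies in both [tH] and [tcH], which puts [c] in
   [H]. *)
apply: nHc; rewrite -(root_unique nx re re') in He'.
by have := HM _ _ He (HV _ He'); rewrite !grpE.
Qed.

(** * The case where [i] generically commutes with its conjugates *)

Hypothesis no_unipotent :
  forall U : G -> Prop, two_unipotent U -> is_normal U -> forall u, U u -> u = one G.

Lemma conj_i_mul g h : conj_i (g ** h) = inv h ** (conj_i g ** h).
Proof. by rewrite /conj_i !grpE. Qed.

Lemma commute_conj x y h : commute x y ->
  commute (inv h ** (x ** h)) (inv h ** (y ** h)).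
Proof. by rewrite /commute => E; rewrite !grpE (mulA x) (mulA y) E. Qed.

Lemma commute_sym x y : commute x y -> commute y x.
Proof. by rewrite /commute => ->. Qed.

(** Some [x] has [i] commuting with both its conjugate by [x] and its conjugate by [x ** inv h].
    Conjugating the latter relation by [h] links [conj_i h] to [conj_i x], and transitivity links
    [i] to [conj_i h]. *)
Lemma commute_all_conj : generic (fun g => commute i (conj_i g)) ->
  forall h, commute i (conj_i h).
Proof.
move=> gY h.
have [x [Yx Yhx]] := connected_generic_meet conG gY (generic_translate_r (inv h) gY).
have E : conj_i x = inv h ** (conj_i (x ** inv h) ** h) by rewrite -conj_i_mul !grpE.
have := commute_conj h Yhx; rewrite -E -/(conj_i h) => /commute_sym Yxh.
exact: (comm_equiv inv_i (involution_conj_i x) (involution_conj_i h)).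
Qed.

Lemma central_of_commute_all_conj : (forall h, commute i (conj_i h)) ->
  forall g, centralizer i g.
Proof.
move=> Ci.
pose E x := x ** x = one G /\ commute x i.
have commE x y : E x -> E y -> commute x y.
  move=> [xx Cx] [yy Cy].
  case: (classic (x = one G)) => [->|x1]; first by rewrite /commute mul1g mulg1.
  case: (classic (y = one G)) => [->|y1]; first by rewrite /commute mul1g mulg1.
  exact: (comm_equiv (conj x1 xx) inv_i (conj y1 yy) Cx (commute_sym Cy)).
have dE : definable1 E by rewrite /E; solve_def.
have sE : is_subgroup E.
  have [C1 [CM CV]] := centralizer_subgroup i.
  split; [by split; [exact: mul1g | exact: C1] | split].
    move=> x y Ex Ey; have Cxy := commE _ _ Ex Ey.
    case: Ex Ey => [xx Cx] [yy Cy]; split; last exact: CM.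
    by rewrite {1}Cxy mulgA' (mulA x) xx mul1g.
  move=> x [xx Cx]; split; last exact: CV.
  by rewrite (invg_eq xx).
have nE : is_normal E.
  move=> g x [xx Cx]; split; first by rewrite !grpE (mulA x) xx !grpE.
  case: (classic (x = one G)) => [->|x1]; first by rewrite mul1g mulVg /commute mul1g mulg1.
  have x1' : involution (inv g ** (x ** g)).
    split; last by rewrite !grpE (mulA x) xx !grpE.
    move=> K; apply: x1; apply: (@mulIg g); apply: (@mulgI (inv g)).
    by rewrite K mul1g mulVg.
  (* The conjugate of [x] commutes with [conj_i g], which commutes with [i]. *)
  apply: (comm_equiv x1' (involution_conj_i g) inv_i); first exact: commute_conj.
  exact/commute_sym/Ci.
have [K [dK sK KE fK conK]] := exists_connected_component dE sE.
have [K1 [KM KV]] := sK.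
have nK : is_normal K.
  move=> g h Kh.
  (* [K] and its conjugate [Kg] both have finite index in [E], so by connectedness [K] lies in their
     intersection. *)
  pose Kg x := K (inv g ** (x ** g)).
  have sKg : is_subgroup Kg.
    rewrite /Kg; split; [by rewrite mul1g mulVg | split=> [x y Kx Ky|x Kx]].
      by have := KM _ _ Kx Ky; rewrite !grpE.
    by have := KV _ Kx; rewrite !grpE.
  have dKg : definable1 Kg by rewrite /Kg; solve_def.
  have fKg : finite_index Kg E.
    have [s Hs] := fK; exists (List.map (fun t => g ** (t ** inv g)) s) => x Ex.
    have [t [ts Kt]] := Hs _ (nE g x Ex); exists (g ** (t ** inv g)).
    split; first exact: (List.in_map (fun t => g ** (t ** inv g))).
    by rewrite /Kg; move: Kt; rewrite !grpE.
  have [s Hs] := finite_index_inter sK sKg fK fKg.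
  have : K h /\ Kg h; last by case.
  apply: (conK (fun x => K x /\ Kg x)) => //; first by solve_def.
  - have [? [gM gV]] := sKg; split=> //; split=> [x y [? ?] [? ?]|x [? ?]]; split; auto.
  - by move=> x [].
  - by exists s => x /KE /Hs.
have K_trivial : forall x, K x -> x = one G.
  apply: no_unipotent => //; split=> //; split=> //; split=> //; split.
    (* [K] is abelian, hence of class 1, and of exponent dividing [2 ^ 1]. *)
    exists 1 => x [|y [|]] // Kx _ Ky /=.
    have Cxy : commute x y by apply: commE; apply: KE => //; apply: Ky; left.
    by rewrite /commg Cxy !grpE.
  by exists 1 => x /KE [xx _]; rewrite /= mulg1.
have [s Hs] := fK.
have Es x : E x -> List.In x s.
  move=> /Hs [t [ts /K_trivial H]]; have -> // : x = t.
  by rewrite -(mulVKg' t x) H mulg1.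
have Cfin : finite_index (centralizer i) (fun _ => True).
  (* All conjugates of [i] lie in the finite set [E], and elements giving the same conjugate differ
     by an element of C(i). *)
  apply: (@finite_index_fibers _ (fun g => g ** (i ** inv g)) _ s) => [g|t g Etg].
    have -> : g ** (i ** inv g) = conj_i (inv g) by rewrite /conj_i invgK'.
    by apply: Es; split; [exact: conj_i_sq | exact/commute_sym/Ci].
  rewrite /centralizer /commute; apply: (@mulIg (inv g)); apply: (@mulgI t).
  by rewrite !grpE Etg.
by move=> g; apply: (conG (definable_centralizer i) (centralizer_subgroup i)).
Qed.

End Centralizer.
End Group.

Theorem theorem5 (G : FMRGroup) :
  connected (fun _ : G => True) ->
  commutation_equiv_on_involutions G ->
  (forall U : G -> Prop, two_unipotent U -> is_normal U -> forall u, U u -> u = one G) ->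
  forall i : G, involution i -> connected (centralizer i).
Proof.
move=> conG comm_equiv no_unipotent i inv_i.
have d : definable1 (fun g => commute i (conj_i i g)) by rewrite /conj_i; solve_def.
case: (generic_split d (generic_true G)) => gX; last first.
  apply: connected_centralizer_of_generic => //.
  by apply: generic_sub gX; [apply: def_compl | move=> g []].
have gY : generic (fun g => commute i (conj_i i g)) by apply: generic_sub gX => // g [].
have Ci := central_of_commute_all_conj conG inv_i comm_equiv no_unipotent
  (commute_all_conj conG inv_i comm_equiv gY).
(* Here C(i) is all of G, which is connected by hypothesis. *)
have -> // : centralizer i = (fun _ => True) by apply: set_ext => g; split.
Qed.
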